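(* For $(p,q)\in\mathbb{R}^2$ let $\Phi_{p,q}\colon \mathrm{Sym}_3\to\mathrm{Sym}_3$ be the linear map sending the symmetric matrix $Z=[z_{ij}]_{i,j=0}^{2}$ to the symmetric matrix $W=[w_{ij}]_{i,j=0}^2$ with entries $$\begin{aligned} w_{00}&=p^2(pq-1)^2 z_{00}+q(2p-q)z_{11},\\ w_{01}&=w_{10}=-pq(1-q^2+p^2q^2)z_{01},\\ w_{02}&=w_{20}=(pq-1)(p^2+pq-p^3q-q^2+p^2q^2)z_{02},\\ w_{11}&=p^2q^3(2p-q)z_{00}+q^2(pq-1)^2z_{11}+q(2p-q)z_{22},\\ w_{12}&=w_{21}=-pq(1-q^2+p^2q^2)z_{12},\\ w_{22}&=q(2p-q)(1-p^2q^2)z_{00}+p^2q^3(2p-q)z_{11}+p^2(pq-1)^2z_{22}. \end{aligned}$$ Then $\Phi_{p,q}$ is positive for every $(p,q)$ in the region $$\left\{(p,q)\in[0,1/\sqrt2]\times[0,\sqrt2]\colon 2p-q\ge 0,\ (p^2-1)^2q^2-p^2\ge 0\right\}.$$ Moreover, for every $(p,q)$ in this region that does not lie on the line $q=2p$, the map $\Phi_{p,q}$ is extremal and is not completely positive.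
   Context: $\mathrm{Sym}_3$ is the space of real symmetric $3\times 3$ matrices; rows and columns are indexed by $0,1,2$. A linear map $\Phi\colon \mathrm{Sym}_3\to \mathrm{Sym}_3$ is positive if it maps positive semidefinite matrices to positive semidefinite matrices. It is completely positive if there exist $l\in\mathbb{N}$ and real $3\times 3$ matrices $B_1,\dots,B_l$ with $\Phi(xx^T)=\sum_{i=1}^l B_i xx^T B_i^T$ for all $x\in\mathbb{R}^3$; equivalently, the biquadratic form $y^T\Phi(xx^T)y$ in $x,y\in\mathbb{R}^3$ is a sum of squares of bilinear forms. A positive map on $\mathrm{Sym}_3$ is extremal if it cannot be written as a sum of two linearly independent positive maps $\mathrm{Sym}_3\to\mathrm{Sym}_3$. *)

(* Defs.v *)
From HB Require Import structures.
From mathcomp Require Import all_boot all_order all_algebra.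
From mathcomp Require Import reals ring.

Set Implicit Arguments.
Unset Strict Implicit.
Unset Printing Implicit Defensive.

Import Order.TTheory GRing.Theory Num.Theory.
Local Open Scope ring_scope.

Section Sym3.
Variable R : realType.

Definition symvs : {vspace 'M[R]_3} := fixedSpace (linfun trmx).

Lemma symvsP (A : 'M[R]_3) : reflect (A^T = A) (A \in symvs).
Proof. by rewrite -[A^T](lfunE trmx); apply: fixedSpaceP. Qed.

Definition Sym3 := subvs_of symvs.
HB.instance Definition _ := Vector.on Sym3.

Definition sym3 (A : 'M[R]_3) (symA : A^T = A) : Sym3 :=
  Subvs (introT (symvsP A) symA).

Lemma sqr_sym (x : 'cV[R]_3) : (x *m x^T)^T = x *m x^T.
Proof. by rewrite trmx_mul trmxK. Qed.

Definition sqr_col (x : 'cV[R]_3) : Sym3 := sym3 (sqr_sym x).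

Definition psd (A : Sym3) : Prop :=
  forall x : 'cV[R]_3, 0 <= (x^T *m vsval A *m x) 0 0.

Definition positive_map (Phi : 'End(Sym3)) : Prop :=
  forall A : Sym3, psd A -> psd (Phi A).

Definition completely_positive (Phi : 'End(Sym3)) : Prop :=
  exists (l : nat) (B : 'I_l -> 'M[R]_3), forall x : 'cV[R]_3,
    vsval (Phi (sqr_col x)) = \sum_(i < l) B i *m (x *m x^T) *m (B i)^T.

(* [free [:: Phi1; Phi2]] is linear independence in the vector space 'End(Sym3). *)
Definition extremal (Phi : 'End(Sym3)) : Prop :=
  positive_map Phi /\
  ~ exists Phi1 Phi2 : 'End(Sym3),
      [/\ positive_map Phi1, positive_map Phi2, free [:: Phi1; Phi2]
        & Phi = Phi1 + Phi2].

(* The row and column indices 0, 1, 2 of [z] are the elements of 'I_3, written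
   with its numerals modulo 3; the last branch of the match is unreachable. *)
Definition Phi_mx (p q : R) (z : 'M[R]_3) : 'M[R]_3 :=
  \matrix_(i < 3, j < 3)
    match val i, val j with
    | 0%N, 0%N =>
        p ^+ 2 * (p * q - 1) ^+ 2 * z 0 0 + q * (2 * p - q) * z 1 1
    | 0%N, 1%N | 1%N, 0%N =>
        - p * q * (1 - q ^+ 2 + p ^+ 2 * q ^+ 2) * z 0 1
    | 0%N, 2%N | 2%N, 0%N =>
        (p * q - 1)
        * (p ^+ 2 + p * q - p ^+ 3 * q - q ^+ 2 + p ^+ 2 * q ^+ 2) * z 0 2
    | 1%N, 1%N =>
        p ^+ 2 * q ^+ 3 * (2 * p - q) * z 0 0
        + q ^+ 2 * (p * q - 1) ^+ 2 * z 1 1 + q * (2 * p - q) * z 2 2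
    | 1%N, 2%N | 2%N, 1%N =>
        - p * q * (1 - q ^+ 2 + p ^+ 2 * q ^+ 2) * z 1 2
    | 2%N, 2%N =>
        q * (2 * p - q) * (1 - p ^+ 2 * q ^+ 2) * z 0 0
        + p ^+ 2 * q ^+ 3 * (2 * p - q) * z 1 1
        + p ^+ 2 * (p * q - 1) ^+ 2 * z 2 2
    | _, _ => 0
    end.

Lemma Phi_mx_sym p q z : (Phi_mx p q z)^T = Phi_mx p q z.
Proof.
by apply/matrixP=> -[[|[|[|i]]] Hi] [[|[|[|j]]] Hj]; rewrite !mxE.
Qed.

Lemma Phi_mx_linear p q : linear (Phi_mx p q).
Proof.
by move=> a A B; apply/matrixP=> -[[|[|[|i]]] Hi] [[|[|[|j]]] Hj];
   rewrite !mxE //=; ring.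
Qed.

Definition Phi_fun (p q : R) (Z : Sym3) : Sym3 :=
  sym3 (Phi_mx_sym p q (vsval Z)).

Lemma Phi_fun_linear p q : linear (Phi_fun p q).
Proof. by move=> a A B; apply: val_inj; rewrite /= Phi_mx_linear. Qed.

HB.instance Definition _ p q :=
  GRing.isLinear.Build R Sym3 Sym3 *:%R (Phi_fun p q) (Phi_fun_linear p q).

(* [linfun] is faithful only on linear functions; [PhiE] confirms that no junk
   value arises here. *)
Definition Phi (p q : R) : 'End(Sym3) := linfun (Phi_fun p q).

Lemma PhiE p q Z : vsval (Phi p q Z) = Phi_mx p q (vsval Z).
Proof. by rewrite lfunE. Qed.

Definition region (p q : R) : Prop :=
  [/\ 0 <= p <= 1 / Num.sqrt 2, 0 <= q <= Num.sqrt 2, 0 <= 2 * p - q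
    & 0 <= (p ^+ 2 - 1) ^+ 2 * q ^+ 2 - p ^+ 2].

End Sym3.

(* Main.v *)
Require Import Defs.
From mathcomp Require Import all_boot all_order all_algebra.
From mathcomp Require Import reals ring lra.
Import Order.TTheory GRing.Theory Num.Theory.
Local Open Scope ring_scope.

(** Attach to a linear map [Psi] on symmetric matrices the biquadratic form
    [biquad Psi x y], which is y^T Psi(x x^T) y. Write s = 1 - pq, w = 2p - q,
    r = (1 - p^2) q + p and f for the form of [Phi p q]. Everything rests on
    the identity [biquad_PhiE]:

      f = s^2 (p x0y0 - q x1y1 + p x2y2)^2
          + w (q (x1y0 - pq x0y1)^2 + q (x2y1 - pq x1y2)^2
               + q (1 - p^2 q^2) (x0y2)^2 - 2 s r (x0y0)(x2y2)).

    On the line w = 0 this is one square. Off the line the region forces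
    0 < p, 0 < q, pq < 1, q < 2p and p <= (1 - p^2) q ([region_off_line]).

    Positivity. Every positive semidefinite matrix is a nonnegative combination
    of squares x x^T ([positive_map_sqr]), so f >= 0 suffices. For fixed x
    this is a ternary quadratic form in y, and its principal minors decide. The
    2x2 minors are visibly nonnegative. The determinant is (q s w)^2 times a
    ternary cubic in the squares (X, Y, Z) of the coordinates of x, and this
    cubic has a node at (1, 1, 1). Seen from the point (0, 0, 1) of the cubic,
    it is quadratic in Z, and because of the node its discriminant is a
    square times X times a linear form in X and Y. Where that linear form is
    nonpositive, the discriminant settles the matter; where it is positive, all
    coefficients of the quadratic are nonnegative ([nodal_cubic_ge0]).

    Extremality. The form f vanishes at nine points ([zeros]). If
    [Phi p q] is a sum of two positive maps, then both of their forms vanish at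
    these points too, and, being nonnegative, with all first derivatives
    ([zero_stationary]).
    These are linear equations for the 36 coefficients of such a form. The set
    of zeros is stable under simultaneous sign changes of x and y, so the
    equations split into four small systems, one for each parity of monomials.
    The three odd systems have only the zero solution and the even one has a
    line of solutions ([zeros_proportional]). Hence both summands are multiples
    of [Phi p q].

    Not completely positive. If f were a sum of squares of bilinear forms
    y^T B x, each of them would vanish at the nine zeros. This forces the
    coefficient of x1 y0 in it to be 0 ([not_completely_positive]), although
    the coefficient of x1^2 y0^2 in f is qw > 0. *)

Set Implicit Arguments.
Unset Strict Implicit.
Unset Printing Implicit Defensive.

(** * Quadratic forms of symmetric matrices *)

Definition qform {R : pzRingType} {n : nat} (A : 'M[R]_n) (x : 'cV[R]_n) : R :=
  (x^T *m A *m x) 0 0.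

Lemma bilinear_sym (R : comPzRingType) (n : nat) (A : 'M[R]_n)
    (x y : 'cV[R]_n) :
  A^T = A -> (x^T *m A *m y) 0 0 = (y^T *m A *m x) 0 0.
Proof.
move=> symA; have -> : x^T *m A *m y = (y^T *m A *m x)^T.
  by rewrite !trmx_mul trmxK symA mulmxA.
by rewrite mxE.
Qed.

Lemma qformDZ (R : comPzRingType) (n : nat) (A : 'M[R]_n) (x y : 'cV[R]_n) c :
  A^T = A ->
  qform A (x + c *: y)
  = qform A x + 2 * c * (y^T *m A *m x) 0 0 + c ^+ 2 * qform A y.
Proof.
move=> symA; rewrite /qform [(x + _)^T]linearD linearZ /= !mulmxDl !mulmxDr.
rewrite -!scalemxAl -!scalemxAr.
rewrite ![fun_of_matrix (_ + _) _ _]mxE ![fun_of_matrix (_ *: _) _ _]mxE.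
by rewrite (bilinear_sym x y symA); ring.
Qed.

Lemma qform_sqr (R : comPzRingType) (n : nat) (u x : 'cV[R]_n) :
  qform (u *m u^T) x = (u^T *m x) 0 0 ^+ 2.
Proof.
rewrite /qform mulmxA -mulmxA mxE big_ord1 expr2; congr (_ * _).
by rewrite -[u in LHS]trmxK -trmx_mul mxE.
Qed.

Lemma col_sqr_eq0 (R : realDomainType) (n : nat) (z : 'cV[R]_n) :
  (z^T *m z) 0 0 = 0 -> z = 0.
Proof.
move=> /eqP; rewrite mxE psumr_eq0 => [/allP z0|i _]; last first.
  by rewrite mxE -expr2 sqr_ge0.
apply/colP=> i; move: (z0 i (mem_index_enum i)).
by rewrite /= !mxE -expr2 sqrf_eq0 => /eqP.
Qed.

(** At a zero y of a nonnegative form, moving along z = A y changes the value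
    at first order by 2 |z|^2, so z must vanish. *)
Lemma psd_kernel (R : realFieldType) (n : nat) (A : 'M[R]_n) (y : 'cV[R]_n) :
  A^T = A -> (forall x, 0 <= qform A x) -> qform A y = 0 -> A *m y = 0.
Proof.
move=> symA psdA Ay0; apply: col_sqr_eq0; set z := A *m y.
set N := (_ *m z) 0 0; set C := qform A z.
have Nz : (z^T *m A *m y) 0 0 = N by rewrite -mulmxA.
have C0 : 0 <= C by exact: psdA.
have C1 : C + 1 != 0 by rewrite gt_eqF // ltr_wpDl.
(* A negative step short enough for the quadratic term C not to compensate:
   C + 1 rather than C because C may be 0. *)
have := psdA (y + (- N / (C + 1)) *: z); rewrite qformDZ // Ay0 Nz -/C.
have -> : 0 + 2 * (- N / (C + 1)) * N + (- N / (C + 1)) ^+ 2 * C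
   = - (N ^+ 2 * ((C + 2) / (C + 1) ^+ 2)) by field.
rewrite oppr_ge0 pmulr_lle0; last first.
  by rewrite divr_gt0 ?exprn_gt0 // ltr_wpDl.
by move=> N2; apply/eqP; rewrite -sqrf_eq0 eq_le N2 sqr_ge0.
Qed.

Lemma qform_eq0 (R : realFieldType) (n : nat) (A : 'M[R]_n) :
  A^T = A -> (forall x, qform A x = 0) -> A = 0.
Proof.
move=> symA A0; apply/matrixP=> i j; rewrite mxE.
have Aj : A *m delta_mx j 0 = 0 :> 'cV_n.
  by apply: psd_kernel => // x; rewrite A0.
by have /colP/(_ i) := Aj; rewrite -colE !mxE.
Qed.

Lemma sum3 (V : nmodType) (F : 'I_3 -> V) : \sum_i F i = F 0 + F 1 + F 2.
Proof.
rewrite !big_ord_recl big_ord0 addr0 addrA.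
by congr (F _ + F _ + F _); apply/val_inj.
Qed.

Lemma qformE (R : comPzRingType) (n : nat) (A : 'M[R]_n) (x : 'cV[R]_n) :
  qform A x = \sum_i \sum_j A i j * x i 0 * x j 0.
Proof.
rewrite /qform mxE exchange_big; apply: eq_bigr => j _ /=.
rewrite mxE big_distrl; apply: eq_bigr => i _ /=; rewrite mxE; ring.
Qed.

Lemma binary_form_ge0 (R : realFieldType) (a b c u v : R) :
  0 <= a -> 0 <= c -> b ^+ 2 <= a * c ->
  0 <= a * u ^+ 2 + 2 * b * u * v + c * v ^+ 2.
Proof.
move=> a0 c0 disc; move: a0; rewrite le_eqVlt => /predU1P[a_eq0|a_gt0].
  have b0 : b = 0.
    apply/eqP; rewrite -sqrf_eq0 eq_le sqr_ge0 andbT.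
    by rewrite (le_trans disc)// -a_eq0 mul0r.
  by rewrite -a_eq0 b0 mulr0 !mul0r !add0r mulr_ge0 ?sqr_ge0.
rewrite -(pmulr_rge0 _ a_gt0).
have -> : a * (a * u ^+ 2 + 2 * b * u * v + c * v ^+ 2)
    = (a * u + b * v) ^+ 2 + (a * c - b ^+ 2) * v ^+ 2 by ring.
by rewrite addr_ge0 ?sqr_ge0 // mulr_ge0 ?sqr_ge0 ?subr_ge0.
Qed.

(** After multiplication by [m00] and completion of the square in [u], there
    remains a binary form whose determinant is [m00] times the one of the
    ternary form. *)
Lemma ternary_form_ge0 (R : realFieldType)
    (m00 m01 m02 m11 m12 m22 u v w : R) :
  0 < m00 -> 0 <= m00 * m11 - m01 ^+ 2 -> 0 <= m00 * m22 - m02 ^+ 2 ->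
  0 <= m00 * m11 * m22 + 2 * m01 * m02 * m12
       - m00 * m12 ^+ 2 - m11 * m02 ^+ 2 - m22 * m01 ^+ 2 ->
  0 <= m00 * u ^+ 2 + m11 * v ^+ 2 + m22 * w ^+ 2
       + 2 * m01 * u * v + 2 * m02 * u * w + 2 * m12 * v * w.
Proof.
move=> m0 m1 m2 det; rewrite -(pmulr_rge0 _ m0).
have -> : m00 * (m00 * u ^+ 2 + m11 * v ^+ 2 + m22 * w ^+ 2
       + 2 * m01 * u * v + 2 * m02 * u * w + 2 * m12 * v * w)
  = (m00 * u + m01 * v + m02 * w) ^+ 2
  + ((m00 * m11 - m01 ^+ 2) * v ^+ 2 + 2 * (m00 * m12 - m01 * m02) * v * w
     + (m00 * m22 - m02 ^+ 2) * w ^+ 2) by ring.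
rewrite addr_ge0 ?sqr_ge0 ?binary_form_ge0 // -subr_ge0.
have -> : (m00 * m11 - m01 ^+ 2) * (m00 * m22 - m02 ^+ 2)
    - (m00 * m12 - m01 * m02) ^+ 2
  = m00 * (m00 * m11 * m22 + 2 * m01 * m02 * m12
       - m00 * m12 ^+ 2 - m11 * m02 ^+ 2 - m22 * m01 ^+ 2) by ring.
by rewrite mulr_ge0 // ltW.
Qed.

(** * Maps on symmetric matrices as biquadratic forms *)

Section PositiveMaps.
Variable R : realType.
Implicit Types (A : Sym3 R) (Phi : 'End(Sym3 R)).

Lemma sym3_sym A : (vsval A)^T = vsval A.
Proof. by case: A => B /= ?; apply/symvsP. Qed.

(** The convex cone of positive semidefinite matrices is generated by the
    squares x x^T: as long as d = e_k^T A e_k is nonzero, subtracting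
    d^-1 (A e_k)(A e_k)^T keeps A positive semidefinite and puts e_k in its
    kernel; d = 0 puts it there already. *)
Lemma positive_map_sqr Phi :
  (forall x, psd (Phi (sqr_col x))) -> positive_map Phi.
Proof.
move=> Phi_sqr A.
(* [m] bounds the indices of the basis vectors still outside the kernel. *)
suff key m : forall A, psd A ->
    (forall i : 'I_3, (m <= i)%N -> vsval A *m delta_mx i 0 = 0 :> 'cV_3) ->
    psd (Phi A).
  by move=> psdA; apply: (key 3%N A psdA) => i; rewrite leqNgt ltn_ord.
elim: m => [|m IHm] {}A psdA A0.
  suff -> : A = 0 by move=> x; rewrite linear0 mulmx0 mul0mx mxE.
  apply/val_inj/matrixP=> i j /=.
  by have /colP/(_ i) := A0 j isT; rewrite -colE !mxE.
have [m3|m3] := leqP 3 m.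
  by apply: IHm psdA _ => i mi; have := leq_trans m3 mi; rewrite leqNgt ltn_ord.
pose k := Ordinal m3; pose e : 'cV[R]_3 := delta_mx k 0.
set u := vsval A *m e; set d := qform (vsval A) e.
have d0 : 0 <= d by exact: psdA.
have Alast (i : 'I_3) :
    (m <= i)%N -> i != k -> vsval A *m delta_mx i 0 = 0 :> 'cV_3.
  move=> mi ik; apply: A0; rewrite ltn_neqAle mi andbT.
  by apply: contraNneq ik => mi'; apply/eqP/val_inj.
have [de|dn] := eqVneq d 0.
  have u0 : u = 0 := psd_kernel (sym3_sym A) psdA de.
  by apply: IHm psdA _ => i mi; have [->|/(Alast i mi)] := eqVneq i k.
pose A' := A - d^-1 *: sqr_col u.
have uT (x : 'cV_3) : u^T *m x = e^T *m vsval A *m x.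
  by rewrite trmx_mul sym3_sym.
have A'E : vsval A' = vsval A - d^-1 *: (u *m u^T) by [].
have psdA' : psd A'.
  move=> x; set c := (e^T *m vsval A *m x) 0 0.
  (* The form of A' at x is the minimum of the form of A on x + R e. *)
  suff -> : (x^T *m vsval A' *m x) 0 0 = qform (vsval A) (x + (- c / d) *: e).
    exact: psdA.
  rewrite qformDZ ?sym3_sym // -/c -/d A'E.
  rewrite mulmxBr mulmxBl -scalemxAr -scalemxAl.
  rewrite ![fun_of_matrix (_ - _) _ _]mxE ![fun_of_matrix (- _) _ _]mxE.
  rewrite ![fun_of_matrix (_ *: _) _ _]mxE -/(qform _ x).
  rewrite -/(qform (u *m u^T) x) qform_sqr uT -/c.
  by field.
have -> : A = A' + d^-1 *: sqr_col u by rewrite subrK.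
move=> x; rewrite linearD linearZ /= mulmxDr mulmxDl -scalemxAr -scalemxAl.
rewrite [fun_of_matrix (_ + _) _ _]mxE [fun_of_matrix (_ *: _) _ _]mxE.
rewrite addr_ge0 ?mulr_ge0 ?invr_ge0 //; last exact: Phi_sqr.
apply: IHm psdA' _ _ => i mi.
rewrite A'E mulmxBl -scalemxAl -mulmxA uT.
have [->|/(Alast i mi) Ai] := eqVneq i k; last first.
  by rewrite Ai -mulmxA Ai !mulmx0 scaler0 subrr.
rewrite [e^T *m _ *m _]mx11_scalar -/(qform _ e) -/d mul_mx_scalar scalerA.
by rewrite mulVf // scale1r subrr.
Qed.

End PositiveMaps.

(** By polarization in x and in y this form determines the map, see
    [biquad_inj]; all the arguments below are about forms. *)
Definition biquad {R : realType} (Phi : 'End(Sym3 R)) (x y : 'cV[R]_3) : R :=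
  qform (vsval (Phi (sqr_col x))) y.

Section Tensor.
Variable R : realType.
Implicit Types (Phi : 'End(Sym3 R)) (x y : 'cV[R]_3).

Lemma sym_unit_subproof (i j : 'I_3) :
  (2^-1 *: (delta_mx i j + delta_mx j i) : 'M[R]_3)^T
  = 2^-1 *: (delta_mx i j + delta_mx j i).
Proof. by rewrite linearZ linearD /= !trmx_delta addrC. Qed.

Definition sym_unit (i j : 'I_3) : Sym3 R := sym3 (sym_unit_subproof i j).

(** Symmetrizing the matrix units makes [tens] symmetric in its first two
    indices, and the factor 1/2 in [sym_unit] gives [biquadE] the same shape on
    and off the diagonal. *)
Definition tens Phi (i j k l : 'I_3) : R := vsval (Phi (sym_unit i j)) k l.

Lemma tens_symx Phi i j k l : tens Phi i j k l = tens Phi j i k l.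
Proof.
by congr (vsval (Phi _) k l); apply/val_inj; rewrite /= [X in _ *: X]addrC.
Qed.

Lemma tens_symy Phi i j k l : tens Phi i j k l = tens Phi i j l k.
Proof. by rewrite /tens -[in LHS]sym3_sym mxE. Qed.

Lemma sym3_sum (Z : Sym3 R) :
  Z = \sum_i \sum_j vsval Z i j *: sym_unit i j.
Proof.
apply/val_inj; rewrite raddf_sum /=.
under eq_bigr do rewrite raddf_sum /=.
have trZ : \sum_i \sum_j vsval Z i j *: delta_mx j i = vsval Z.
  rewrite -[RHS]sym3_sym [X in _ = X^T]matrix_sum_delta linear_sum.
  apply: eq_bigr => i _; rewrite linear_sum; apply: eq_bigr => j _ /=.
  by rewrite linearZ /= trmx_delta.
under eq_bigr => i _.
  under eq_bigr => j _ do rewrite scalerA mulrC -scalerA scalerDr.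
  rewrite -scaler_sumr big_split; over.
rewrite -scaler_sumr big_split /= trZ -matrix_sum_delta -mulr2n -scaler_nat.
by rewrite scalerA mulVf ?scale1r ?pnatr_eq0.
Qed.

Lemma mapE Phi Z k l :
  vsval (Phi Z) k l = \sum_i \sum_j tens Phi i j k l * vsval Z i j.
Proof.
rewrite {1}(sym3_sum Z) linear_sum raddf_sum summxE; apply: eq_bigr => i _.
rewrite linear_sum raddf_sum summxE; apply: eq_bigr => j _.
by rewrite linearZ /= mxE mulrC.
Qed.

Lemma sqr_colE x i j : vsval (sqr_col x) i j = x i 0 * x j 0.
Proof. by rewrite /= mxE big_ord1 mxE. Qed.

(** The form [biquad Phi x y] read as a quadratic form in x, for fixed y. *)
Definition xform Phi y : 'M[R]_3 :=
  \matrix_(i, j) \sum_k \sum_l tens Phi i j k l * (y k 0 * y l 0).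

Lemma xform_sym Phi y : (xform Phi y)^T = xform Phi y.
Proof.
apply/matrixP=> i j; rewrite !mxE.
by apply: eq_bigr => k _; apply: eq_bigr => l _; rewrite tens_symx.
Qed.

Lemma biquadE Phi x y : biquad Phi x y = \sum_i \sum_j \sum_k \sum_l
  tens Phi i j k l * (x i 0 * x j 0) * (y k 0 * y l 0).
Proof.
pose F k l i j := tens Phi i j k l * (x i 0 * x j 0) * (y k 0 * y l 0).
transitivity (\sum_k \sum_l \sum_i \sum_j F k l i j).
  rewrite /biquad qformE; apply: eq_bigr => k _; apply: eq_bigr => l _.
  rewrite mapE -mulrA mulr_suml; apply: eq_bigr => i _.
  by rewrite mulr_suml; apply: eq_bigr => j _; rewrite sqr_colE.
under eq_bigr do rewrite exchange_big; rewrite exchange_big /=.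
apply: eq_bigr => i _.
under eq_bigr do rewrite exchange_big; rewrite exchange_big /=.
by [].
Qed.

Lemma qform_xform Phi x y : qform (xform Phi y) x = biquad Phi x y.
Proof.
rewrite biquadE qformE; apply: eq_bigr => i _; apply: eq_bigr => j _.
rewrite mxE -mulrA mulr_suml; apply: eq_bigr => k _.
by rewrite mulr_suml; apply: eq_bigr => l _; rewrite mulrAC.
Qed.

Lemma biquad_inj Phi Psi :
  (forall x y, biquad Phi x y = biquad Psi x y) -> Phi = Psi.
Proof.
move=> eqf; apply/eqP; rewrite -subr_eq0; set D := Phi - Psi.
have D0 x y : biquad D x y = 0.
  rewrite /biquad /qform [vsval _](_ : _ = vsval (Phi (sqr_col x)) -
    vsval (Psi (sqr_col x))); last by rewrite !lfunE /= !lfunE.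
  rewrite mulmxBr mulmxBl mxE [X in _ + X]mxE.
  by apply/eqP; rewrite subr_eq0; apply/eqP; exact: eqf.
have T0 i j k l : tens D i j k l = 0.
  pose N : 'M[R]_3 := \matrix_(i, j) tens D i j k l.
  suff -> : tens D i j k l = N i j.
    suff -> : N = 0 by rewrite mxE.
    apply: qform_eq0; first by apply/matrixP=> a b; rewrite !mxE tens_symx.
    move=> x; have Dx : vsval (D (sqr_col x)) = 0.
      by apply: qform_eq0; [exact: sym3_sym | exact: D0].
    rewrite qformE -[RHS](_ : vsval (D (sqr_col x)) k l = 0); last first.
      by rewrite Dx mxE.
    rewrite mapE; apply: eq_bigr => a _; apply: eq_bigr => b _.
    by rewrite mxE sqr_colE mulrA.
  by rewrite mxE.
apply/eqP/lfunP=> Z; rewrite [RHS]lfunE; apply/val_inj/matrixP=> k l.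
rewrite mapE [RHS]mxE big1 // => i _; rewrite big1 // => j _.
by rewrite T0 mul0r.
Qed.

(** For fixed x and for fixed y the form is a nonnegative quadratic form, so
    its zero lies in the kernel: both gradients of the biquadratic form
    vanish. *)
Lemma zero_stationary Phi x y :
  (forall x y, 0 <= biquad Phi x y) -> biquad Phi x y = 0 ->
  vsval (Phi (sqr_col x)) *m y = 0 /\ xform Phi y *m x = 0.
Proof.
move=> Phi_ge0 xy0; split; apply: psd_kernel.
- exact: sym3_sym.
- exact: Phi_ge0.
- exact: xy0.
- exact: xform_sym.
- by move=> z; rewrite qform_xform.
- by rewrite qform_xform.
Qed.

End Tensor.

(** * Positivity *)

(** The weight 2p - q isolates what disappears on the line q = 2p. The
    square in front contains all the terms x_i^2 y_i^2. *)
Lemma biquad_PhiE (R : realType) (p q : R) (x y : 'cV[R]_3) :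
  biquad (Phi p q) x y =
  (1 - p * q) ^+ 2
    * (p * x 0 0 * y 0 0 - q * x 1 0 * y 1 0 + p * x 2 0 * y 2 0) ^+ 2
  + (2 * p - q)
    * (q * (x 1 0 * y 0 0 - p * q * x 0 0 * y 1 0) ^+ 2
       + q * (x 2 0 * y 1 0 - p * q * x 1 0 * y 2 0) ^+ 2
       + q * (1 - p ^+ 2 * q ^+ 2) * (x 0 0 * y 2 0) ^+ 2
       - 2 * (1 - p * q) * (q + p - p ^+ 2 * q)
         * (x 0 0 * y 0 0) * (x 2 0 * y 2 0)).
Proof.
rewrite /biquad PhiE qformE !sum3 /Phi_mx !mxE /= !big_ord1 !mxE.
ring.
Qed.

(** Up to the factor (q (1 - pq) (2p - q))^2 this is the determinant of
    [Phi p q] at x x^T, with X, Y, Z the squares of the coordinates of x. The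
    plane cubic has a node at (1, 1, 1) and touches the lines Z = 0 and X = 0
    at (1, p^2, 0) and (0, 1, q^2). *)
Lemma nodal_cubic_ge0 (R : realFieldType) (p q X Y Z : R) :
  0 < p -> 0 < q -> p * q < 1 -> p ^+ 2 < 1 -> p <= (1 - p ^+ 2) * q ->
  0 <= X -> 0 <= Y -> 0 <= Z ->
  0 <= (((1 - p ^+ 2) ^+ 2 * q ^+ 2 - p ^+ 2) * X + p ^+ 2 * Y) * Z ^+ 2
    + (p ^+ 2 * (p ^+ 4 * q ^+ 4 - 2 * p ^+ 2 * q ^+ 4 - 2 * p ^+ 2 * q ^+ 2
                 + q ^+ 4 + 1) * X ^+ 2
       + (- p ^+ 6 * q ^+ 4 + 2 * p ^+ 4 * q ^+ 4 - p ^+ 2 * q ^+ 4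
          + 6 * p ^+ 2 * q ^+ 2 - p ^+ 2 - 2 * q ^+ 2) * X * Y
       - 2 * p ^+ 2 * q ^+ 2 * Y ^+ 2) * Z
    + q ^+ 2 * (Y - p ^+ 2 * X) ^+ 2
      * (p ^+ 2 * q ^+ 2 * Y + (1 - p ^+ 2 * q ^+ 2) * X).
Proof.
move=> p0 q0 pq1 p1 tpos X0 Y0 Z0.
set m := 1 - p ^+ 2 in tpos *.
have m0 : 0 < m by rewrite subr_gt0.
have [p_ge0 q_ge0 m_ge0] := And3 (ltW p0) (ltW q0) (ltW m0).
have mqp : p ^+ 2 <= m ^+ 2 * q ^+ 2.
  by rewrite -exprMn ler_sqr ?nnegrE // mulr_ge0.
have pq2 : p ^+ 2 * q ^+ 2 < 1.
  by rewrite -exprMn expr_lt1 // mulr_ge0.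
set g2 := (_ * X + _ * Y).
set g1 := (_ - _ * Y ^+ 2).
set g0 := (q ^+ 2 * _ * _).
have g2_ge0 : 0 <= g2.
  by rewrite addr_ge0 // mulr_ge0 ?subr_ge0 ?sqr_ge0.
have g0_ge0 : 0 <= g0.
  rewrite mulr_ge0 //; first by rewrite mulr_ge0 ?sqr_ge0.
  rewrite addr_ge0 //; first by rewrite !mulr_ge0.
  by rewrite mulr_ge0 // subr_ge0 ltW.
set N := p ^+ 2 * (1 + q ^+ 2 * m) ^+ 2.
set D := 4 * m * q ^+ 2.
(* The factor (Y - X)^2 comes from the node, the factor X from the contact
   with the line X = 0. *)
have disc : g1 ^+ 2 - 4 * g2 * g0
    = ((Y - X) * p * (1 - q ^+ 2 * m)) ^+ 2 * X * (N * X - D * Y).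
  by rewrite /g1 /g2 /g0 /N /D /m; ring.
have [le_ND|lt_DN] := lerP (N * X) (D * Y).
  have disc_le0 : g1 ^+ 2 - 4 * g2 * g0 <= 0.
    by rewrite disc mulr_ge0_le0 ?subr_le0 // mulr_ge0 ?sqr_ge0.
  have -> : g2 * Z ^+ 2 + g1 * Z + g0
      = g2 * Z ^+ 2 + 2 * (g1 / 2) * Z * 1 + g0 * 1 ^+ 2 by field.
  apply: binary_form_ge0 => //.
  have -> : (g1 / 2) ^+ 2 = g1 ^+ 2 / 4 by field.
  by rewrite ler_pdivrMr //; lra.
(* Now N X > D Y, and [g1] is nonnegative: it is concave in Y, so it is enough
   to look at Y = 0, where it is [al] X^2, and at N X = D Y, where it is
   (c / D^2) X^2. The identity [key] is this interpolation. The constant c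
   factors because the discriminant vanishes at N X = D Y, so that there the
   square of g1 is 4 g2 g0. *)
suff g1_ge0 : 0 <= g1.
  by rewrite addr_ge0 // addr_ge0 // mulr_ge0 ?sqr_ge0.
set al := p ^+ 2 * (m ^+ 2 * q ^+ 4 + 1 - 2 * p ^+ 2 * q ^+ 2).
have al_ge0 : 0 <= al.
  rewrite mulr_ge0 ?sqr_ge0 //.
  have : p ^+ 2 * q ^+ 2 <= m ^+ 2 * q ^+ 4.
    have -> : m ^+ 2 * q ^+ 4 = m ^+ 2 * q ^+ 2 * q ^+ 2 by ring.
    by rewrite ler_wpM2r ?sqr_ge0.
  by lra.
have D0 : 0 < D by rewrite !mulr_gt0 ?exprn_gt0.
have N0 : 0 < N.
  by rewrite !mulr_gt0 ?exprn_gt0 // addr_gt0 // mulr_gt0 // exprn_gt0.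
set c := 2 * p ^+ 2 * q ^+ 2 * (1 - q ^+ 2 * m) ^+ 2
           * (1 + m - m * (p ^+ 2 * q ^+ 2))
           * (m * (1 + m) * q ^+ 2 - p ^+ 2).
have key : D * N * g1 = D * al * X * (N * X - D * Y)
     + Y * (c * X + 2 * p ^+ 2 * q ^+ 2 * N * (N * X - D * Y)).
  by rewrite /g1 /al /c /D /N /m; ring.
have c_ge0 : 0 <= c.
  have mpq : m * (p ^+ 2 * q ^+ 2) <= m.
    by rewrite -[leRHS]mulr1 ler_wpM2l // ltW.
  have mq2 : 0 <= m * q ^+ 2 by rewrite mulr_ge0 ?sqr_ge0.
  have f1 : 0 <= 1 + m - m * (p ^+ 2 * q ^+ 2) by lra.
  have f2 : 0 <= m * (1 + m) * q ^+ 2 - p ^+ 2.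
    have -> : m * (1 + m) * q ^+ 2 - p ^+ 2
      = m * q ^+ 2 + (m ^+ 2 * q ^+ 2 - p ^+ 2) by ring.
    by rewrite addr_ge0 // subr_ge0.
  by rewrite /c mulr_ge0 // mulr_ge0 // mulr_ge0 ?sqr_ge0 // !mulr_ge0.
rewrite -(pmulr_rge0 _ (mulr_gt0 D0 N0)) key.
have ND_ge0 : 0 <= N * X - D * Y by rewrite subr_ge0 ltW.
have N_ge0 := ltW N0; have D_ge0 := ltW D0.
rewrite addr_ge0 //; first by rewrite mulr_ge0 // mulr_ge0 // mulr_ge0.
rewrite mulr_ge0 // addr_ge0 //; first by rewrite mulr_ge0.
by rewrite mulr_ge0 // mulr_ge0 // mulr_ge0 ?sqr_ge0 // mulr_ge0 ?sqr_ge0.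
Qed.

(** The inequalities that hold in the region away from the line q = 2p; the
    last one is the last inequality of the region without the squares. *)
Record off_line (R : realFieldType) (p q : R) : Prop := OffLine {
  _ : 0 < p;
  _ : 0 < q;
  _ : p * q < 1;
  _ : q < 2 * p;
  _ : p ^+ 2 < 1;
  _ : p <= (1 - p ^+ 2) * q }.

Lemma region_off_line (R : realType) (p q : R) :
  region p q -> q <> 2 * p -> off_line p q.
Proof.
move=> [/andP[p0 p_le] /andP[q0 _] w0 mq] q_neq.
have q2p : q < 2 * p by rewrite lt_neqAle -subr_ge0 w0 andbT; apply/eqP.
have p_gt0 : 0 < p by lra.
have p2 : p ^+ 2 * 2 <= 1.
  move: p_le; rewrite ler_pdivlMr ?sqrtr_gt0 //.
  rewrite -(ler_sqr (x := p * _)) ?nnegrE ?mulr_ge0 ?sqrtr_ge0 //.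
  by rewrite exprMn sqr_sqrtr // expr1n.
have m_gt0 : 0 < 1 - p ^+ 2 by lra.
have pmq : p <= (1 - p ^+ 2) * q.
  rewrite -ler_sqr ?nnegrE ?mulr_ge0 // ?(ltW m_gt0) // -subr_ge0.
  by rewrite (_ : _ - _ = (p ^+ 2 - 1) ^+ 2 * q ^+ 2 - p ^+ 2) //; ring.
have q_gt0 : 0 < q by rewrite -(pmulr_rgt0 _ m_gt0) (lt_le_trans p_gt0).
split => //; last by lra.
have : p * q < p * (2 * p) by rewrite ltr_pM2l.
by rewrite mulrCA -expr2; lra.
Qed.

(** Off the line the first diagonal entry vanishes only for x0 = x1 = 0, where
    the form is a sum of squares; elsewhere the minors decide. *)
Lemma biquad_Phi_ge0 (R : realType) (p q : R) (x y : 'cV[R]_3) :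
  off_line p q -> 0 <= biquad (Phi p q) x y.
Proof.
case=> p0 q0 pq1 q2p p1 pmq; rewrite biquad_PhiE.
set x0 := x 0 0; set x1 := x 1 0; set x2 := x 2 0.
set y0 := y 0 0; set y1 := y 1 0; set y2 := y 2 0.
have [p_ge0 q_ge0] := (ltW p0, ltW q0).
have w0 : 0 < 2 * p - q by rewrite subr_gt0.
have s0 : 0 < 1 - p * q by rewrite subr_gt0.
have [w_ge0 s_ge0] := (ltW w0, ltW s0).
have pq2 : 0 <= 1 - p ^+ 2 * q ^+ 2.
  by rewrite -exprMn subr_ge0 expr_le1 ?mulr_ge0 // ltW.
set a := p ^+ 2 * (1 - p * q) ^+ 2; set b := q * (2 * p - q).
have a0 : 0 < a by rewrite mulr_gt0 ?exprn_gt0.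
have b0 : 0 < b by rewrite mulr_gt0.
have [a_ge0 b_ge0] := (ltW a0, ltW b0).
set c := - (p * q * ((1 - p * q) ^+ 2 + b)).
set t := (1 - p ^+ 2) * q - p; set r := (1 - p ^+ 2) * q + p.
have t_ge0 : 0 <= t by rewrite subr_ge0.
have r_ge0 : 0 <= r by rewrite addr_ge0 // (le_trans p_ge0).
set d := a - (1 - p * q) * (2 * p - q) * r.
have ad : d ^+ 2 <= a ^+ 2.
  rewrite -subr_ge0.
  have -> : a ^+ 2 - d ^+ 2
      = ((1 - p * q) * (2 * p - q) * r) * ((1 - p * q) * q * t).
    by rewrite /d /a /t /r; ring.
  by rewrite mulr_ge0 // mulr_ge0 // mulr_ge0.
set m00 := a * x0 ^+ 2 + b * x1 ^+ 2.
set m11 := p ^+ 2 * q ^+ 2 * b * x0 ^+ 2 + q ^+ 2 * (1 - p * q) ^+ 2 * x1 ^+ 2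
            + b * x2 ^+ 2.
set m22 := b * (1 - p ^+ 2 * q ^+ 2) * x0 ^+ 2 + p ^+ 2 * q ^+ 2 * b * x1 ^+ 2
            + a * x2 ^+ 2.
rewrite [leRHS](_ : _ = m00 * y0 ^+ 2 + m11 * y1 ^+ 2 + m22 * y2 ^+ 2
       + 2 * (c * x0 * x1) * y0 * y1 + 2 * (d * x0 * x2) * y0 * y2
       + 2 * (c * x1 * x2) * y1 * y2); last first.
  rewrite /m00 /m11 /m22 /c /d /a /b /r; ring.
have m22_ge0 : 0 <= b * (1 - p ^+ 2 * q ^+ 2) * x0 ^+ 2
    + p ^+ 2 * q ^+ 2 * b * x1 ^+ 2.
  have sq_ge0 := @sqr_ge0 R.
  by rewrite addr_ge0 // mulr_ge0 // mulr_ge0 // mulr_ge0.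
have ax_ge0 : 0 <= a * x0 ^+ 2 by rewrite mulr_ge0 ?sqr_ge0.
have bx_ge0 : 0 <= b * x1 ^+ 2 by rewrite mulr_ge0 ?sqr_ge0.
have m00_ge0 : 0 <= m00 by rewrite addr_ge0.
move: m00_ge0; rewrite le_eqVlt => /predU1P[/esym/eqP m00_eq0|m00_gt0].
  move: m00_eq0; rewrite paddr_eq0 //.
  rewrite (mulf_eq0 a) (mulf_eq0 b) !sqrf_eq0 (gt_eqF a0) (gt_eqF b0) /=.
  move=> /andP[/eqP x0_0 /eqP x1_0].
  rewrite [leRHS](_ : _ = b * (x2 * y1) ^+ 2 + a * (x2 * y2) ^+ 2).
    by rewrite addr_ge0 // mulr_ge0 ?sqr_ge0.
  by rewrite /m00 /m11 /m22 x0_0 x1_0; ring.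
apply: ternary_form_ge0 => //.
(* For x2 = 0 this minor is a square up to a factor: in the coordinates 0 and 1
   the form has the zero x = (1, p, 0), y = (q, 1, 0). *)
- have -> : m00 * m11 - (c * x0 * x1) ^+ 2
    = b * (m00 * x2 ^+ 2
           + (q * (1 - p * q) * (x1 ^+ 2 - p ^+ 2 * x0 ^+ 2)) ^+ 2).
    by rewrite /m00 /m11 /c /a /b; ring.
  by rewrite mulr_ge0 // addr_ge0 ?sqr_ge0 // mulr_ge0 ?sqr_ge0 // ltW.
- have -> : m00 * m22 - (d * x0 * x2) ^+ 2
    = m00 * (b * (1 - p ^+ 2 * q ^+ 2) * x0 ^+ 2
              + p ^+ 2 * q ^+ 2 * b * x1 ^+ 2)
      + (a * b * (x1 * x2) ^+ 2 + (a ^+ 2 - d ^+ 2) * (x0 * x2) ^+ 2).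
    by rewrite /m22 /m00; ring.
  rewrite addr_ge0 //; first by rewrite mulr_ge0 // ltW.
  rewrite addr_ge0 //; first by rewrite mulr_ge0 ?sqr_ge0 // mulr_ge0.
  by rewrite mulr_ge0 ?sqr_ge0 // subr_ge0.
have := nodal_cubic_ge0 p0 q0 pq1 p1 pmq
  (sqr_ge0 x0) (sqr_ge0 x1) (sqr_ge0 x2).
set g := (g in 0 <= g -> _) => g_ge0.
rewrite [leRHS](_ : _ = (q * (1 - p * q) * (2 * p - q)) ^+ 2 * g).
  by rewrite mulr_ge0 ?sqr_ge0.
by rewrite /g /m00 /m11 /m22 /c /d /a /b /r; ring.
Qed.

Lemma positive_map_Phi (R : realType) (p q : R) :
  region p q -> positive_map (Phi p q).
Proof.
move=> reg; apply: positive_map_sqr => x y.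
rewrite -/(qform _ y) -/(biquad _ x y).
have [->|/eqP q2p] := eqVneq q (2 * p).
  by rewrite biquad_PhiE subrr mul0r addr0 mulr_ge0 ?sqr_ge0.
exact/biquad_Phi_ge0/region_off_line.
Qed.

(** * The nine zeros *)

Definition col3 {R : realType} (a b c : R) : 'cV[R]_3 :=
  \col_i [:: a; b; c]`_i.

(** The point (e2, e0), and the orbits of ((1, p, 0), (q, 1, 0)),
    ((0, 1, q), (0, p, 1)) and ((1, 1, 1), (1, 1, 1)) under simultaneous sign
    changes of the coordinates of x and y. *)
Definition zeros {R : realType} (p q : R) : seq ('cV[R]_3 * 'cV[R]_3) :=
  [:: (col3 0 0 1, col3 1 0 0);
      (col3 1 p 0, col3 q 1 0); (col3 1 (- p) 0, col3 q (- 1) 0);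
      (col3 0 1 q, col3 0 p 1); (col3 0 1 (- q), col3 0 p (- 1));
      (col3 1 1 1, col3 1 1 1); (col3 1 1 (- 1), col3 1 1 (- 1));
      (col3 1 (- 1) 1, col3 1 (- 1) 1); (col3 (- 1) 1 1, col3 (- 1) 1 1)].

Lemma col3E (R : realType) (a b c : R) :
  (col3 a b c 0 0 = a) * (col3 a b c 1 0 = b) * (col3 a b c 2 0 = c).
Proof. by rewrite !mxE. Qed.

Lemma biquad_zeros (R : realType) (p q : R) :
  all (fun z => biquad (Phi p q) z.1 z.2 == 0) (zeros p q).
Proof.
rewrite /= !biquad_PhiE !col3E.
by do !(apply/andP; split=> //); apply/eqP; ring.
Qed.

(** At the zeros ((1, p, 0), (q, 1, 0)) and ((1, -p, 0), (q, -1, 0)) the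
    vanishing of y^T B x gives pq B01 + B10 = 0, and at the four sign vectors
    it gives B01 + B10 = 0. As pq < 1, this leaves B01 = 0. *)
Lemma not_completely_positive (R : realType) (p q : R) :
  off_line p q -> ~ completely_positive (Phi p q).
Proof.
case=> p0 q0 pq1 q2p _ _ [l [B PhiB]].
pose v m (x y : 'cV[R]_3) : R := (y^T *m B m *m x) 0 0.
have sumB x y : biquad (Phi p q) x y = \sum_(m < l) v m x y ^+ 2.
  rewrite /biquad /qform PhiB mulmx_sumr mulmx_suml summxE.
  apply: eq_bigr => m _; have <- : ((B m *m x)^T *m y) 0 0 = v m x y.
    by rewrite /v -[in RHS]mulmxA -[B m *m x in RHS]trmxK -trmx_mul [RHS]mxE.
  by rewrite -qform_sqr /qform trmx_mul !mulmxA.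
have vE m x y : v m x y = \sum_i \sum_j B m i j * y i 0 * x j 0.
  rewrite /v mxE exchange_big; apply: eq_bigr => j _ /=.
  rewrite mxE mulr_suml; apply: eq_bigr => i _.
  by rewrite mxE [X in X * _]mulrC.
have vz m : all (fun z => v m z.1 z.2 == 0) (zeros p q).
  apply: sub_all (biquad_zeros p q) => -[x y] /=.
  rewrite sumB psumr_eq0 => [/allP/(_ m (mem_index_enum m))|i _].
    by rewrite sqrf_eq0.
  exact: sqr_ge0.
have B01 m : B m 0 1 = 0.
  have := vz m; rewrite /= !vE !sum3 !col3E.
  case/and5P=> _ /eqP z1 /eqP z2 _ /and5P[_ /eqP z5 /eqP z6 /eqP z7].
  rewrite andbT => /eqP z8.
  have B10 : B m 1 0 = - B m 0 1 by lra.
  have : (1 - p * q) * B m 0 1 = 0 by rewrite B10 in z1 z2; lra.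
  by move/eqP; rewrite mulf_eq0 subr_eq0 (gt_eqF pq1) /= => /eqP.
have : biquad (Phi p q) (col3 0 1 0) (col3 1 0 0) = 0.
  by rewrite sumB big1 // => m _; rewrite vE !sum3 !col3E B01; ring.
rewrite biquad_PhiE !col3E => /eqP; apply/negP.
rewrite [X in X == _](_ : _ = q * (2 * p - q)); last by ring.
by rewrite mulf_neq0 // gt_eqF // subr_gt0.
Qed.

(** * Nonnegative forms vanishing at the nine zeros *)

(** The four linear systems for the coefficients T_ijkl of a form that is
    stationary at all the zeros, one system for each parity class of the
    monomials x_i x_j y_k y_l under simultaneous sign changes. *)
Section ZeroSystems.
Variables (R : realFieldType) (p q : R).
Hypotheses (p0 : 0 < p) (q0 : 0 < q) (pq1 : p * q < 1).

(** Class of x0 x1: u_k is T_01kk, v_i is T_ii01 with T_2201 = 0 already used,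
    M is T_0212 and N is T_1202. All unknowns are multiples of N, and the fifth
    equation becomes 2 pq (pq - 1) N = 0. *)
Lemma odd01_system (u0 u1 u2 v0 v1 M N : R) :
  2 * q * v0 + p * (q ^+ 2 * u0 + u1) = 0 ->
  q ^+ 2 * u0 + u1 + 2 * p * q * v1 = 0 ->
  2 * p * q * u0 + v0 + p ^+ 2 * v1 = 0 ->
  p * v1 + 2 * q * N = 0 ->
  p ^+ 2 * u1 + u2 + 2 * p * q * M = 0 ->
  u2 + M + N = 0 ->
  M + N = 0 ->
  [/\ u0 = 0, u1 = 0 & u2 = 0] /\
  [/\ v0 = 0, v1 = 0, M = 0 & N = 0].
Proof.
move=> b1 b2 b3 b4 b5 b6 b7.
have [p_n0 q_n0] := (lt0r_neq0 p0, lt0r_neq0 q0).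
have v0E : v0 = p ^+ 2 * v1.
  by apply: (mulfI q_n0); have /= := congr1 ( *%R p) b2; lra.
have u0E : q * u0 = - p * v1.
  by apply: (mulfI p_n0); rewrite v0E in b3; lra.
have NE : u0 = 2 * N by apply: (mulfI q_n0); lra.
have ME : M = - N by lra.
have u2E : u2 = 0 by lra.
have u1E : u1 = q ^+ 2 * u0.
  by have /= := congr1 ( *%R q) u0E; lra.
have N0 : N = 0.
  have pq_n0 : p * q * (p * q - 1) != 0.
    by rewrite !mulf_neq0 // lt_eqF // subr_lt0.
  by apply: (mulfI pq_n0); move: b5; rewrite u1E NE ME u2E; lra.
have u00 : u0 = 0 by rewrite NE N0 mulr0.
have v10 : v1 = 0.
  by apply: (mulfI p_n0); move: u0E; rewrite u00; lra.
by rewrite u1E v0E ME N0 u00 v10 u2E !mulr0 oppr0.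
Qed.

(** Class of x0 x2: u_k is T_02kk and v_i is T_ii02, with T_0200 = T_2202 = 0
    already used, M is T_0112 and N is T_1201. All unknowns are multiples of N,
    and the fourth equation becomes 8 (pq - 1) N = 0. *)
Lemma odd02_system (u1 u2 v0 v1 M N : R) :
  u1 + 2 * p * q * N = 0 ->
  v1 + 2 * p * q * N = 0 ->
  v1 + M + N = 0 ->
  2 * v0 + 2 * M + u1 + u2 = 0 ->
  v0 + v1 + 2 * N = 0 ->
  u1 + u2 + 2 * N = 0 ->
  [/\ u1 = 0, u2 = 0, v0 = 0 & v1 = 0] /\ M = 0 /\ N = 0.
Proof.
move=> d1 d3 d4 d5 d6 d7.
have pq_n0 : p * q - 1 != 0 by rewrite lt_eqF // subr_lt0.
have N0 : N = 0 by apply: (mulfI pq_n0); lra.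
by rewrite N0 in d1 d3 d4 d6 d7 *; do !split; lra.
Qed.

(** Class of x1 x2: u_k is T_12kk with T_1200 = 0 already used, v_i is T_ii12,
    M is T_0102 and N is T_0201. Exchanging x with y and the index 0 with 2
    maps the set of zeros to itself and the class of x0 x1 to this one. *)
Lemma odd12_system (u1 u2 v0 v1 v2 M N : R) :
  2 * p * v1 + q * (p ^+ 2 * u1 + u2) = 0 ->
  p ^+ 2 * u1 + u2 + 2 * p * q * v2 = 0 ->
  2 * p * q * u1 + v1 + q ^+ 2 * v2 = 0 ->
  2 * q * N + p * u1 = 0 ->
  v0 + p ^+ 2 * v1 + 2 * p * q * M = 0 ->
  v0 + M + N = 0 ->
  M + N = 0 ->
  [/\ u1 = 0 & u2 = 0] /\
  [/\ v0 = 0, v1 = 0, v2 = 0, M = 0 & N = 0].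
Proof.
move=> c1 c2 c3 c4 c5 c6 c7.
have [p_n0 q_n0] := (lt0r_neq0 p0, lt0r_neq0 q0).
have v1E : v1 = q ^+ 2 * v2.
  by apply: (mulfI p_n0); have /= := congr1 ( *%R q) c2; lra.
have u1E : p * u1 = - q * v2.
  by apply: (mulfI q_n0); rewrite v1E in c3; lra.
have NE : v2 = 2 * N by apply: (mulfI q_n0); lra.
have ME : M = - N by lra.
have v0E : v0 = 0 by lra.
have N0 : N = 0.
  have pq_n0 : p * q * (p * q - 1) != 0.
    by rewrite !mulf_neq0 // lt_eqF // subr_lt0.
  by apply: (mulfI pq_n0); move: c5; rewrite v1E NE ME v0E; lra.
have u10 : u1 = 0.
  by apply: (mulfI p_n0); move: u1E; rewrite NE N0; lra.
by rewrite v0E v1E ME NE N0 u10 in c2 *; do !split; lra.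
Qed.

(** Even class: A_ik is T_iikk with T_2200 = 0 already used and c_ij is
    T_ijij. The first six equations say that the restrictions to the indices
    {0, 1} and {1, 2} are combinations of the two squares that occur there in
    [Phi p q]; the last five, from the zero ((1, 1, 1), (1, 1, 1)), fix the
    ratio of the two coefficients and determine the rest. *)
Lemma even_system (A00 A01 A02 A10 A11 A12 A21 A22 c01 c02 c12 : R) :
  q * (A00 + p ^+ 2 * A10) + 2 * p * c01 = 0 ->
  A00 * q ^+ 2 + A01 + 2 * p * q * c01 = 0 ->
  2 * p * q * c01 + A01 + p ^+ 2 * A11 = 0 ->
  p * (A11 + q ^+ 2 * A21) + 2 * q * c12 = 0 ->
  A11 * p ^+ 2 + A12 + 2 * p * q * c12 = 0 ->
  2 * p * q * c12 + A12 + q ^+ 2 * A22 = 0 ->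
  A00 + A01 + A02 + 2 * c01 + 2 * c02 = 0 ->
  A10 + A11 + A12 + 2 * c01 + 2 * c12 = 0 ->
  A21 + A22 + 2 * c02 + 2 * c12 = 0 ->
  A00 + A10 + 2 * c01 + 2 * c02 = 0 ->
  A02 + A12 + A22 + 2 * c02 + 2 * c12 = 0 ->
  exists lam, let s := 1 - p * q in let w := 2 * p - q in
  [/\ A00 = lam * (p ^+ 2 * s ^+ 2), A11 = lam * (q ^+ 2 * s ^+ 2)
    & A22 = lam * (p ^+ 2 * s ^+ 2)] /\
  [/\ A10 = lam * (q * w), A01 = lam * (p ^+ 2 * q ^+ 3 * w),
      A21 = lam * (q * w), A12 = lam * (p ^+ 2 * q ^+ 3 * w)
    & A02 = lam * (q * w * (1 - p ^+ 2 * q ^+ 2))] /\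
  [/\ 2 * c01 = - lam * (p * q * (s ^+ 2 + q * w)),
      2 * c12 = - lam * (p * q * (s ^+ 2 + q * w))
    & 2 * c02 = lam * (p ^+ 2 * s ^+ 2 - s * w * (q + p - p ^+ 2 * q))].
Proof.
move=> y0 x0 y1 y3 x3 y4 s0 s1 s2 t0 t2.
set s := 1 - p * q; set w := 2 * p - q.
have [p_n0 q_n0] := (lt0r_neq0 p0, lt0r_neq0 q0).
have s_n0 : s != 0 by rewrite gt_eqF // subr_gt0.
pose lam := A00 / (p ^+ 2 * s ^+ 2); exists lam.
have A00E : A00 = lam * (p ^+ 2 * s ^+ 2).
  by rewrite divfK // mulf_neq0 ?expf_neq0.
have qy0 := congr1 ( *%R q) y0; have py3 := congr1 ( *%R p) y3.
rewrite /= in qy0 py3.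
have A01E : A01 = p ^+ 2 * q ^+ 2 * A10 by lra.
have A12E : A12 = p ^+ 2 * q ^+ 2 * A21 by lra.
have A11E : A11 = lam * (q ^+ 2 * s ^+ 2).
  by apply: (mulfI (expf_neq0 2 p_n0)); rewrite A00E in x0; lra.
have A22E : A22 = lam * (p ^+ 2 * s ^+ 2).
  by apply: (mulfI (expf_neq0 2 q_n0)); rewrite A11E in x3; lra.
have pq2 : 1 - p ^+ 2 * q ^+ 2 != 0.
  by rewrite -exprMn subr_eq0 gt_eqF // expr_lt1 // mulr_ge0 ?ltW.
have A21E : A21 = A10 by apply: (mulfI pq2); lra.
have A10E : A10 = lam * (q * w).
  have k_n0 : p * q * s ^+ 2 != 0 by rewrite !mulf_neq0 ?expf_neq0.
  apply: (mulfI k_n0); have := congr1 ( *%R (p * q)) s1.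
  have := congr1 ( *%R q) y0; have := congr1 ( *%R p) y3.
  by rewrite /= A12E A21E A11E A00E /s /w; lra.
have c01E : 2 * c01 = - lam * (p * q * (s ^+ 2 + q * w)).
  by apply: (mulfI p_n0); rewrite A00E A10E in y0; lra.
have c12E : 2 * c12 = - lam * (p * q * (s ^+ 2 + q * w)).
  by apply: (mulfI q_n0); rewrite A11E A21E A10E in y3; lra.
rewrite A21E A10E in A01E A12E *; split=> //; split; first split=> //.
- by rewrite A01E; ring.
- by rewrite A12E; ring.
- by rewrite A01E A10E in s0 t0; lra.
split=> //.
by rewrite A00E A10E c01E /s /w in t0 *; lra.
Qed.

End ZeroSystems.

Section Rows.
Variables (R : realType) (T : 'End(Sym3 R)).
Hypothesis T_ge0 : forall x y, 0 <= biquad T x y.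
Local Notation t i j k l := (tens T i%R j%R k%R l%R).

(** The stationarity equations at a zero in coordinates, with the first pair of
    indices sorted in the derivatives along y and the last pair in those along
    x. *)
Lemma zero_rows (a b c d e f : R) :
  biquad T (col3 a b c) (col3 d e f) = 0 ->
  (forall k,
    (t 0 0 k 0 * a ^+ 2 + t 1 1 k 0 * b ^+ 2 + t 2 2 k 0 * c ^+ 2
     + 2 * (t 0 1 k 0 * (a * b) + t 0 2 k 0 * (a * c)
            + t 1 2 k 0 * (b * c))) * d
    + (t 0 0 k 1 * a ^+ 2 + t 1 1 k 1 * b ^+ 2 + t 2 2 k 1 * c ^+ 2
     + 2 * (t 0 1 k 1 * (a * b) + t 0 2 k 1 * (a * c)
            + t 1 2 k 1 * (b * c))) * e
    + (t 0 0 k 2 * a ^+ 2 + t 1 1 k 2 * b ^+ 2 + t 2 2 k 2 * c ^+ 2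
     + 2 * (t 0 1 k 2 * (a * b) + t 0 2 k 2 * (a * c)
            + t 1 2 k 2 * (b * c))) * f
    = 0) /\
  (forall k,
    (t k 0 0 0 * d ^+ 2 + t k 0 1 1 * e ^+ 2 + t k 0 2 2 * f ^+ 2
     + 2 * (t k 0 0 1 * (d * e) + t k 0 0 2 * (d * f)
            + t k 0 1 2 * (e * f))) * a
    + (t k 1 0 0 * d ^+ 2 + t k 1 1 1 * e ^+ 2 + t k 1 2 2 * f ^+ 2
     + 2 * (t k 1 0 1 * (d * e) + t k 1 0 2 * (d * f)
            + t k 1 1 2 * (e * f))) * b
    + (t k 2 0 0 * d ^+ 2 + t k 2 1 1 * e ^+ 2 + t k 2 2 2 * f ^+ 2
     + 2 * (t k 2 0 1 * (d * e) + t k 2 0 2 * (d * f)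
            + t k 2 1 2 * (e * f))) * c
    = 0).
Proof.
case/(zero_stationary T_ge0) => Y X; split=> k.
  have /colP/(_ k) := Y; rewrite !mxE !sum3 !mapE !sum3 !sqr_colE !col3E => <-.
  by rewrite !(tens_symx T 1 0) !(tens_symx T 2 0) !(tens_symx T 2 1) /=; ring.
have /colP/(_ k) := X; rewrite !mxE !sum3 !mxE !sum3 !col3E => <-.
rewrite !(tens_symy T _ _ 1 0) !(tens_symy T _ _ 2 0) !(tens_symy T _ _ 2 1).
by rewrite /=; ring.
Qed.

Variables (p q : R).
Hypothesis pq_off : off_line p q.
Hypothesis T_zeros : all (fun z => biquad T z.1 z.2 == 0) (zeros p q).

Let sorted := (tens_symx T 1 0, tens_symx T 2 0, tens_symx T 2 1,
  fun i j => tens_symy T i j 1 0, fun i j => tens_symy T i j 2 0,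
  fun i j => tens_symy T i j 2 1).

(** The default point also is a zero of the form. *)
Lemma zero_at i : biquad T (nth (0, 0) (zeros p q) i).1
                           (nth (0, 0) (zeros p q) i).2 = 0.
Proof.
have [i9|i9] := ltnP i (size (zeros p q)).
  exact/eqP/(all_nthP (0, 0) T_zeros).
rewrite nth_default // /biquad /qform mulmx0 mxE //.
Qed.

Lemma tens_at_e2_e0 :
  [/\ t 2 2 0 0 = 0, t 2 2 0 1 = 0, t 2 2 0 2 = 0, t 0 2 0 0 = 0
    & t 1 2 0 0 = 0].
Proof.
have [Y X] := zero_rows (zero_at 0).
have := (Y 0, Y 1, Y 2, X 0, X 1); rewrite ?sorted => -[[[[y0 y1] y2] x0] x1].
split; lra.
Qed.

(** In this lemma and the next three each equation of the system is the
    component of the required parity of one row of the stationarity equations;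
    it is isolated by combining the rows at the points of one sign orbit. The
    rows 1 to 8 are numbered after the entries of [zeros]. *)
Lemma tens_odd01 : [/\ t 0 1 0 0 = 0, t 0 1 1 1 = 0 & t 0 1 2 2 = 0] /\
  [/\ t 0 0 0 1 = 0, t 1 1 0 1 = 0, t 0 2 1 2 = 0 & t 1 2 0 2 = 0].
Proof.
have [p0 q0 pq1 _ _ _] := pq_off.
have [z20 v2 w2 u02 u12] := tens_at_e2_e0.
have [[Y1 X1] [Y2 X2]] := (zero_rows (zero_at 1), zero_rows (zero_at 2)).
have [[Y3 X3] [Y4 X4]] := (zero_rows (zero_at 3), zero_rows (zero_at 4)).
have [[Y5 X5] [Y6 X6]] := (zero_rows (zero_at 5), zero_rows (zero_at 6)).
have [[Y7 X7] [Y8 X8]] := (zero_rows (zero_at 7), zero_rows (zero_at 8)).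
apply: (@odd01_system _ p q) => //.
- have := X1 0; have := X2 0; rewrite ?sorted; lra.
- have := X1 1; have := X2 1; rewrite ?sorted; lra.
- have := Y1 0; have := Y2 0; rewrite ?sorted; lra.
- have := Y3 0; have := Y4 0; rewrite ?sorted v2; lra.
- have := X3 0; have := X4 0; rewrite ?sorted; lra.
- have := Y5 2; have := Y6 2; have := Y7 2; have := Y8 2.
  rewrite ?sorted; lra.
- have := X5 2; have := X6 2; have := X7 2; have := X8 2.
  rewrite ?sorted v2; lra.
Qed.

Lemma tens_odd02 :
  [/\ t 0 2 1 1 = 0, t 0 2 2 2 = 0, t 0 0 0 2 = 0 & t 1 1 0 2 = 0]
  /\ t 0 1 1 2 = 0 /\ t 1 2 0 1 = 0.
Proof.
have [p0 q0 pq1 _ _ _] := pq_off.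
have [z20 v2 w2 u02 u12] := tens_at_e2_e0.
have [[Y1 X1] [Y2 X2]] := (zero_rows (zero_at 1), zero_rows (zero_at 2)).
have [[Y3 X3] [Y4 X4]] := (zero_rows (zero_at 3), zero_rows (zero_at 4)).
have [[Y5 X5] [Y6 X6]] := (zero_rows (zero_at 5), zero_rows (zero_at 6)).
have [[Y7 X7] [Y8 X8]] := (zero_rows (zero_at 7), zero_rows (zero_at 8)).
apply: (@odd02_system _ p q) => //.
- have := X1 2; have := X2 2; rewrite ?sorted u02; lra.
- have := Y3 0; have := Y4 0; rewrite ?sorted w2; lra.
- have := X5 1; have := X6 1; have := X7 1; have := X8 1.
  rewrite ?sorted; lra.
- have := X5 0; have := X6 0; have := X7 0; have := X8 0.
  rewrite ?sorted u02; lra.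
- have := Y5 0; have := Y6 0; have := Y7 0; have := Y8 0.
  rewrite ?sorted u02 w2; lra.
- have := X5 2; have := X6 2; have := X7 2; have := X8 2.
  rewrite ?sorted u02 w2; lra.
Qed.

Lemma tens_odd12 : [/\ t 1 2 1 1 = 0 & t 1 2 2 2 = 0] /\
  [/\ t 0 0 1 2 = 0, t 1 1 1 2 = 0, t 2 2 1 2 = 0, t 0 1 0 2 = 0
    & t 0 2 0 1 = 0].
Proof.
have [p0 q0 pq1 _ _ _] := pq_off.
have [z20 v2 w2 u02 u12] := tens_at_e2_e0.
have [[Y1 X1] [Y2 X2]] := (zero_rows (zero_at 1), zero_rows (zero_at 2)).
have [[Y3 X3] [Y4 X4]] := (zero_rows (zero_at 3), zero_rows (zero_at 4)).
have [[Y5 X5] [Y6 X6]] := (zero_rows (zero_at 5), zero_rows (zero_at 6)).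
have [[Y7 X7] [Y8 X8]] := (zero_rows (zero_at 7), zero_rows (zero_at 8)).
apply: (@odd12_system _ p q) => //.
- have := X3 1; have := X4 1; rewrite ?sorted; lra.
- have := X3 2; have := X4 2; rewrite ?sorted; lra.
- have := Y3 1; have := Y4 1; rewrite ?sorted; lra.
- have := X1 2; have := X2 2; rewrite ?sorted u12; lra.
- have := Y1 2; have := Y2 2; rewrite ?sorted; lra.
- have := X5 0; have := X6 0; have := X7 0; have := X8 0.
  rewrite ?sorted; lra.
- have := Y5 0; have := Y6 0; have := Y7 0; have := Y8 0.
  rewrite ?sorted u12; lra.
Qed.

Lemma tens_even :
  exists lam, let s := 1 - p * q in let w := 2 * p - q in
  [/\ t 0 0 0 0 = lam * (p ^+ 2 * s ^+ 2), t 1 1 1 1 = lam * (q ^+ 2 * s ^+ 2)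
    & t 2 2 2 2 = lam * (p ^+ 2 * s ^+ 2)] /\
  [/\ t 1 1 0 0 = lam * (q * w), t 0 0 1 1 = lam * (p ^+ 2 * q ^+ 3 * w),
      t 2 2 1 1 = lam * (q * w), t 1 1 2 2 = lam * (p ^+ 2 * q ^+ 3 * w)
    & t 0 0 2 2 = lam * (q * w * (1 - p ^+ 2 * q ^+ 2))] /\
  [/\ 2 * t 0 1 0 1 = - lam * (p * q * (s ^+ 2 + q * w)),
      2 * t 1 2 1 2 = - lam * (p * q * (s ^+ 2 + q * w))
    & 2 * t 0 2 0 2 = lam * (p ^+ 2 * s ^+ 2 - s * w * (q + p - p ^+ 2 * q))].
Proof.
have [p0 q0 pq1 _ _ _] := pq_off.
have [z20 v2 w2 u02 u12] := tens_at_e2_e0.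
have [[Y1 X1] [Y2 X2]] := (zero_rows (zero_at 1), zero_rows (zero_at 2)).
have [[Y3 X3] [Y4 X4]] := (zero_rows (zero_at 3), zero_rows (zero_at 4)).
have [[Y5 X5] [Y6 X6]] := (zero_rows (zero_at 5), zero_rows (zero_at 6)).
have [[Y7 X7] [Y8 X8]] := (zero_rows (zero_at 7), zero_rows (zero_at 8)).
apply: (@even_system _ p q) => //.
- have := Y1 0; have := Y2 0; rewrite ?sorted; lra.
- have := X1 0; have := X2 0; rewrite ?sorted; lra.
- have := Y1 1; have := Y2 1; rewrite ?sorted; lra.
- have := Y3 1; have := Y4 1; rewrite ?sorted; lra.
- have := X3 1; have := X4 1; rewrite ?sorted; lra.
- have := Y3 2; have := Y4 2; rewrite ?sorted; lra.
- have := X5 0; have := X6 0; have := X7 0; have := X8 0.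
  rewrite ?sorted; lra.
- have := X5 1; have := X6 1; have := X7 1; have := X8 1.
  rewrite ?sorted; lra.
- have := X5 2; have := X6 2; have := X7 2; have := X8 2.
  rewrite ?sorted z20; lra.
- have := Y5 0; have := Y6 0; have := Y7 0; have := Y8 0.
  rewrite ?sorted z20; lra.
- have := Y5 2; have := Y6 2; have := Y7 2; have := Y8 2.
  rewrite ?sorted; lra.
Qed.

(** The nine zeros determine the form up to a factor: of its 36 coefficients
    the odd ones vanish, as they do for [Phi p q], and the even ones are
    proportional to those of [Phi p q]. *)
Lemma zeros_proportional : exists lam, T = lam *: Phi p q.
Proof.
have [lam [[a0 a1 a2] [[b10 b01 b21 b12 b02] [c01 c12 c02]]]] := tens_even.
exists lam; apply: biquad_inj => x y.
rewrite [RHS](_ : _ = lam * biquad (Phi p q) x y); last first.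
  by rewrite /biquad /qform lfunE /= -scalemxAr -scalemxAl mxE.
have [z20 v2 w2 u02 u12] := tens_at_e2_e0.
have [[e1 e2 e3] [e4 e5 e6 e7]] := tens_odd01.
have [[f1 f2 f3 f4] [f5 f6]] := tens_odd02.
have [[g1 g2] [g3 g4 g5 g6 g7]] := tens_odd12.
rewrite biquad_PhiE biquadE !sum3 ?sorted.
rewrite z20 v2 w2 u02 u12 e1 e2 e3 e4 e5 e6 e7 f1 f2 f3 f4 f5 f6.
rewrite g1 g2 g3 g4 g5 g6 g7 a0 a1 a2 b10 b01 b21 b12 b02.
have -> : t 0 1 0 1
    = - lam * (p * q * ((1 - p * q) ^+ 2 + q * (2 * p - q))) / 2.
  by lra.
have -> : t 1 2 1 2
    = - lam * (p * q * ((1 - p * q) ^+ 2 + q * (2 * p - q))) / 2.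
  by lra.
have -> : t 0 2 0 2 = lam * (p ^+ 2 * (1 - p * q) ^+ 2
    - (1 - p * q) * (2 * p - q) * (q + p - p ^+ 2 * q)) / 2 by lra.
by field.
Qed.

End Rows.

(** * Extremality *)
(** A zero of the sum of two nonnegative forms is a zero of both, so both
    summands fall under [zeros_proportional]. *)
Lemma extremal_Phi (R : realType) (p q : R) :
  off_line p q -> positive_map (Phi p q) -> extremal (Phi p q).
Proof.
move=> pq_off posPhi; split=> // -[Phi1 [Phi2 [pos1 pos2 free12 PhiD]]].
have biquad_ge0 Psi : positive_map Psi -> forall x y, 0 <= biquad Psi x y.
  move=> posPsi x y; apply: posPsi => v.
  by rewrite -/(qform _ v) qform_sqr sqr_ge0.
have biquadD x y : biquad (Phi p q) x y = biquad Phi1 x y + biquad Phi2 x y.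
  by rewrite PhiD /biquad /qform lfunE /= mulmxDr mulmxDl mxE.
have vanish : all (fun z => (biquad Phi1 z.1 z.2 == 0)
                            && (biquad Phi2 z.1 z.2 == 0)) (zeros p q).
  apply: sub_all (biquad_zeros p q) => -[x y] /=.
  by rewrite biquadD paddr_eq0 ?biquad_ge0.
have [lam Phi1E] : exists lam, Phi1 = lam *: Phi p q.
  apply: zeros_proportional pq_off _; first exact: biquad_ge0.
  by apply: sub_all vanish => z /andP[].
have [mu Phi2E] : exists mu, Phi2 = mu *: Phi p q.
  apply: zeros_proportional pq_off _; first exact: biquad_ge0.
  by apply: sub_all vanish => z /andP[].
move: free12; rewrite free_cons span_seq1 seq1_free => /andP[/negP + Phi2_n0].
apply; have mu_n0 : mu != 0.
  by apply: contraNneq Phi2_n0 => mu0; rewrite Phi2E mu0 scale0r.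
have -> : Phi1 = (lam / mu) *: Phi2 by rewrite Phi1E Phi2E scalerA divfK.
exact/memvZ/memv_line.
Qed.

Theorem theorem7 (R : realType) :
  (forall p q : R, region p q -> positive_map (Phi p q)) /\
  (forall p q : R, region p q -> q <> 2 * p ->
     extremal (Phi p q) /\ ~ completely_positive (Phi p q)).
Proof.
split=> [p q|p q reg q2p]; first exact: positive_map_Phi.
have pq_off := region_off_line reg q2p.
split; last exact: not_completely_positive.
exact/extremal_Phi/positive_map_Phi.
Qed.
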